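(* Let $f$ be a partial Boolean function and $\epsilon\ge 0$. Then $\mathrm{R}_0(f_{\mathrm{sab}})\ge\bar{\mathrm{R}}_\epsilon(f_{\mathrm{sab}})\ge(1-2\epsilon)\mathrm{R}_0(f_{\mathrm{sab}})$.
   Context: A partial Boolean function on $n$ bits is $f:\mathrm{Dom}(f)\to\{0,1\}$ with $\mathrm{Dom}(f)\subseteq\{0,1\}^n$; the same query notions apply to functions with input alphabet $\{0,1,*,\dagger\}$, where a query to position $i$ returns the symbol $x_i$. A randomized algorithm is a probability distribution over deterministic decision trees; it has error $\epsilon$ if on every input in the domain it outputs the correct value with probability at least $1-\epsilon$. $\bar{\mathrm{R}}_\epsilon(h)$ is the minimum, over randomized algorithms for $h$ with error $\epsilon$, of the maximum over inputs in the domain of the expected number of queries; $\mathrm{R}_0(h)=\bar{\mathrm{R}}_0(h)$. Sabotaged function: let $P_f\subseteq\{0,1,*\}^n$ be the set of $p$ such that there exist $x,y\in\mathrm{Dom}(f)$ with $f(x)\ne f(y)$ and $x_i=y_i=p_i$ whenever $p_i\ne *$. Let $P_f^\dagger\subseteq\{0,1,\dagger\}^n$ be the same with $\dagger$ in place of $*$, and $Q_f=P_f\cup P_f^\dagger$. Define $f_{\mathrm{sab}}:Q_f\to\{0,1\}$ by $f_{\mathrm{sab}}(q)=0$ if $q\in P_f$ and $f_{\mathrm{sab}}(q)=1$ if $q\in P_f^\dagger$. *)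

(* Defs.v *)
From HB Require Import structures.
From mathcomp Require Import all_boot all_order all_algebra.
From mathcomp Require Import all_classical all_reals all_analysis.

Set Implicit Arguments.
Unset Strict Implicit.
Unset Printing Implicit Defensive.

Import Order.TTheory GRing.Theory Num.Theory.
Local Open Scope ring_scope.
Local Open Scope classical_set_scope.

(* [h x = None] encodes that [x] lies outside the domain of [h]. *)
Definition partial_fun (n : nat) (A : finType) :=
  {ffun 'I_n -> A} -> option bool.

Inductive dtree (n : nat) (A : Type) : Type :=
| Leaf of bool
| Query of 'I_n & (A -> dtree n A).

Fixpoint output n (A : finType) (t : dtree n A) (x : {ffun 'I_n -> A}) : bool :=
  match t with
  | Leaf b => b
  | Query i k => output (k (x i)) x
  end.

Fixpoint queries n (A : finType) (t : dtree n A) (x : {ffun 'I_n -> A}) : nat :=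
  match t with
  | Leaf _ => 0%N
  | Query i k => (queries (k (x i)) x).+1
  end.

(* There are countably many trees over a finite alphabet; they carry the
   discrete sigma-algebra, so every set of trees is an event. *)
HB.instance Definition _ n A := gen_eqMixin (dtree n A).
HB.instance Definition _ n A := gen_choiceMixin (dtree n A).
HB.instance Definition _ n A := isPointed.Build (dtree n A) (Leaf n A false).
HB.instance Definition _ n A := @isMeasurable.Build default_measure_display
  (dtree n A) discrete_measurable discrete_measurable0
  discrete_measurableC discrete_measurableU.

Definition randomized_algorithm (R : realType) n (A : finType) :=
  probability (dtree n A) R.

Definition has_error (R : realType) n (A : finType) (eps : R)
    (P : randomized_algorithm R n A) (h : partial_fun n A) : Prop :=
  forall x, h x -> ((1 - eps)%:E <= P [set t | h x = Some (output t x)])%E.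

(* The base point 0 only makes the maximum over an empty domain equal to 0:
   all the terms are nonnegative. *)
Definition worst_expected_queries (R : realType) n (A : finType)
    (P : randomized_algorithm R n A) (h : partial_fun n A) : \bar R :=
  (\big[maxe/0]_(x : {ffun 'I_n -> A} | h x)
     'E_P[fun t => (queries t x)%:R])%E.

(* The minimum over algorithms is written as an infimum.  It is attained:
   dropping repeated queries never raises the cost, finitely many trees repeat no
   query, and the distributions on these form a compact simplex. *)
Definition Rbar (R : realType) (eps : R) n (A : finType)
    (h : partial_fun n A) : \bar R :=
  ereal_inf [set worst_expected_queries P h |
             P in [set P : randomized_algorithm R n A | has_error eps P h]].

Definition R0 (R : realType) n (A : finType) (h : partial_fun n A) : \bar R :=
  Rbar (0 : R) h.

Inductive symbol := Bit of bool | Star | Dagger.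

Definition symbol_code (s : symbol) : bool + bool :=
  match s with Bit b => inl b | Star => inr false | Dagger => inr true end.
Definition symbol_decode (c : bool + bool) : symbol :=
  match c with inl b => Bit b | inr false => Star | inr true => Dagger end.
Lemma symbol_codeK : cancel symbol_code symbol_decode.
Proof. by case. Qed.
HB.instance Definition _ := Finite.copy symbol (can_type symbol_codeK).

(* [sabotaged f Star] is P_f and [sabotaged f Dagger] is P_f^dagger.  An entry
   of [p] that is not the mark [s] is forced to be a bit, so [p] is a word over
   {0, 1, s}. *)
Definition sabotaged n (f : partial_fun n bool) (s : symbol)
    (p : {ffun 'I_n -> symbol}) : Prop :=
  exists x y : {ffun 'I_n -> bool},
    [/\ f x, f y, f x <> f y &
        forall i, p i <> s -> p i = Bit (x i) /\ p i = Bit (y i)].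

Definition fsab n (f : partial_fun n bool) : partial_fun n symbol :=
  fun q => if `[< sabotaged f Star q >] then Some false
           else if `[< sabotaged f Dagger q >] then Some true
           else None.

Lemma sabotaged_disjoint n (f : partial_fun n bool) q :
  sabotaged f Star q -> sabotaged f Dagger q -> False.
Proof.
move=> [x [y [_ _ fxy Sxy]]] [x' [y' [_ _ _ Dxy]]]; apply: fxy; congr f.
apply/ffunP => i; case: (eqVneq (q i) Star) => [qS|/eqP qS].
  have [] : q i = Bit (x' i) /\ q i = Bit (y' i) by apply: Dxy; rewrite qS.
  by rewrite qS.
by have [-> []] := Sxy i qS.
Qed.

Lemma fsab_false n (f : partial_fun n bool) q :
  fsab f q = Some false <-> sabotaged f Star q.
Proof.
rewrite /fsab; case: asboolP => [PS|nPS]; first by split.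
by case: asboolP => _; split.
Qed.

(* [P_f] and [P_f^dagger] being disjoint, the order of the two tests in [fsab]
   is immaterial. *)
Lemma fsab_true n (f : partial_fun n bool) q :
  fsab f q = Some true <-> sabotaged f Dagger q.
Proof.
rewrite /fsab; case: asboolP => [PS|_]; last first.
  by case: asboolP; split.
by split=> // /(sabotaged_disjoint PS).
Qed.

(* Main.v *)
From HB Require Import structures.
Require Import Defs.
From mathcomp Require Import all_boot all_order all_algebra.
From mathcomp Require Import all_classical all_reals all_analysis.
From mathcomp Require Import ring lra.

(** Let P compute f_sab with error eps, and let Q compute it without error.
    Run a tree drawn from P until it reads a mark, which reveals the value of
    f_sab; if it reads none, run a tree drawn from Q.  This is a zero-error
    algorithm.  A tree that reads no mark on q answers alike on q and on the
    input obtained from q by exchanging [Star] and [Dagger], where f_sab takes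
    the opposite value, so it errs on one of the two; this happens with
    probability at most 2 eps.  Hence R0 <= cost P + 2 eps * cost Q, and taking
    the infimum over Q gives (1 - 2 eps) R0 <= cost P. *)

Set Implicit Arguments.
Unset Strict Implicit.
Unset Printing Implicit Defensive.

Import Order.TTheory GRing.Theory Num.Theory.

(** * Countability of decision trees and measurability on pairs of trees *)

Section DtreeMeasurable.
Local Open Scope classical_set_scope.
Variables (n : nat) (A : finType).

(** Over a finite alphabet the branches of a query can be listed, which embeds the trees into a
    countable type. *)
Fixpoint dtree_code (t : dtree n A) : GenTree.tree bool :=
  match t with
  | Leaf b => GenTree.Leaf b
  | Query i k => GenTree.Node i [seq dtree_code (k a) | a <- enum A]
  end.

Lemma dtree_code_inj : injective dtree_code.
Proof.
elim=> [b|i k IH] [b'|j k'] //= []; first by move=> ->.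
move=> /val_inj -> /eq_in_map kk'; congr Query; apply/funext => a.
by apply: IH; apply: kk'; rewrite mem_enum.
Qed.

Lemma countable_dtree : countable [set: dtree n A].
Proof.
apply/countable_injP; exists (pickle \o dtree_code) => t u _ _ /=.
by move/(pcan_inj pickleK)/dtree_code_inj.
Qed.

(** The first component ranges over a countable set, so [B] is a countable union of rectangles with
    a single tree as first factor. *)
Lemma measurable_dtree2 (B : set (dtree n A * dtree n A)) : measurable B.
Proof.
have -> : B = \bigcup_t ([set t] `*` xsection B t).
  apply/seteqP; split=> [[t u] Btu|[t u] [t' _ [/= ->]]].
    by exists t => //; split=> //; rewrite xsectionE.
  by rewrite xsectionE.
apply: (countable_bigcupT_measurable countable_dtree) => t.
by apply: measurableX.
Qed.

Lemma measurable_fun_dtree2 d (T : sigmaRingType d)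
  (D : set (dtree n A * dtree n A)) (g : dtree n A * dtree n A -> T) :
  measurable_fun D g.
Proof. by move=> _ B _; exact: measurable_dtree2. Qed.

End DtreeMeasurable.

(** * Independent pairs: the product of two probabilities *)

Section ProductProbability.
Local Open Scope classical_set_scope.
Context d1 d2 (T1 : measurableType d1) (T2 : measurableType d2) (R : realType).
Variables (P : probability T1 R) (Q : probability T2 R).

Lemma product_probability_setT : (P \x Q)%E [set: T1 * T2] = 1%E.
Proof.
rewrite -setXTT product_measure1E// -[RHS]mule1.
by congr (_ * _)%E; exact: probability_setT.
Qed.

HB.instance Definition _ :=
  Measure_isProbability.Build _ _ _ (P \x Q)%E product_probability_setT.

End ProductProbability.

(** * Exchanging the marks, and running one tree after another *)

Section Resume.
Variable n : nat.
Implicit Types (t s : dtree n symbol) (q : {ffun 'I_n -> symbol}).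

Definition swap_mark (a : symbol) : symbol :=
  match a with Bit b => Bit b | Star => Dagger | Dagger => Star end.

Definition swap_marks q : {ffun 'I_n -> symbol} := [ffun i => swap_mark (q i)].

Definition is_bit (a : symbol) : bool := if a is Bit _ then true else false.

Fixpoint reads_no_mark t q : bool :=
  match t with
  | Leaf _ => true
  | Query i k => is_bit (q i) && reads_no_mark (k (q i)) q
  end.

(** The first mark read settles the answer. At a leaf the bit of [t] is discarded and [s] starts
    afresh. *)
Fixpoint resume t s : dtree n symbol :=
  match t with
  | Leaf _ => s
  | Query i k => Query i (fun a =>
      match a with
      | Bit b => resume (k (Bit b)) s
      | Star => Leaf n symbol false
      | Dagger => Leaf n symbol true
      end)
  end.

(** The exchange fixes every bit, so [t] follows the same path on both inputs. *)
Lemma output_swap_marks t q :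
  reads_no_mark t q -> output t (swap_marks q) = output t q.
Proof.
elim: t => //= i k IH; rewrite ffunE; case: (q i) => //= b.
exact: IH.
Qed.

(** Strict inequality is possible only when a mark is read: [resume] then stops, while [t] may go
    on. *)
Lemma queries_resume t s q :
  queries (resume t s) q <= queries t q + reads_no_mark t q * queries s q.
Proof.
elim: t => [b|i k IH] /=; first by rewrite mul1n.
by case: (q i) => [b| |] /=; rewrite ?addSn// ltnS IH.
Qed.

End Resume.

(** * How marks determine the sabotaged function *)

Section Sabotage.
Variables (n : nat) (f : partial_fun n bool).
Implicit Types (t s : dtree n symbol) (q : {ffun 'I_n -> symbol}).

Lemma fsab_Star q i b : fsab f q = Some b -> q i = Star -> b = false.
Proof.
case: b => // /fsab_true [x [y [_ _ _ H]]] qi.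
by have [] : q i = Bit (x i) /\ q i = Bit (y i); [apply: H; rewrite qi|rewrite qi].
Qed.

Lemma fsab_Dagger q i b : fsab f q = Some b -> q i = Dagger -> b = true.
Proof.
case: b => // /fsab_false [x [y [_ _ _ H]]] qi.
by have [] : q i = Bit (x i) /\ q i = Bit (y i); [apply: H; rewrite qi|rewrite qi].
Qed.

(** The pair [x], [y] that witnesses [q] also witnesses [swap_marks q]. *)
Lemma fsab_swap_marks q b :
  fsab f q = Some b -> fsab f (swap_marks q) = Some (~~ b).
Proof.
case: b => [/fsab_true|/fsab_false] [x [y [fx fy fxy H]]];
  [apply/fsab_false|apply/fsab_true]; exists x, y; split=> // i;
  rewrite ffunE; move: (H i); case: (q i) => [c| |] Hi ne;
  by first [exact: Hi|case: Hi|case: ne].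
Qed.

(** If all entries were bits, the witnesses [x] and [y] would both coincide with [q], against
    [f x <> f y]. *)
Lemma fsab_has_mark q : fsab f q -> exists i, ~~ is_bit (q i).
Proof.
move=> fq; apply/existsP; apply: contraT; rewrite negb_exists => /forallP allb.
have qbit i : is_bit (q i) by have := allb i; rewrite negbK.
have [m [m_mark [x [y [_ _ fxy H]]]]] :
    exists m, ~~ is_bit m /\ sabotaged f m q.
  case E: (fsab f q) fq => [[]|] // _; first by exists Dagger; move/fsab_true: E.
  by exists Star; move/fsab_false: E.
case: fxy; congr f; apply/ffunP => i.
have [|-> []//] := H i.
by move=> qi; move: m_mark; rewrite -qi qbit.
Qed.

(** A mark gives the right answer by itself, so [s] has to be right only when [t] reads none. *)
Lemma output_resume t s q : fsab f q ->
  reads_no_mark t q ==> (fsab f q == Some (output s q)) ->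
  fsab f q = Some (output (resume t s) q).
Proof.
case E: (fsab f q) => [b|] // _.
elim: t => [c|i k IH] /=; first by move/eqP.
case Q: (q i) => [c| |] /=.
- exact: IH.
- by rewrite (fsab_Star E Q).
- by rewrite (fsab_Dagger E Q).
Qed.

(** Queries all positions and hence meets a mark on every input of the domain; its leaf bit is
    arbitrary. *)
Definition scan : dtree n symbol :=
  foldr (fun i t => Query i (fun=> t)) (Leaf n symbol false) (enum 'I_n).

Lemma scan_reads_mark q : fsab f q -> reads_no_mark scan q = false.
Proof.
move=> /fsab_has_mark [i qi]; rewrite /scan.
have : i \in enum 'I_n by rewrite mem_enum.
elim: (enum _) => //= j l IH; rewrite in_cons => /orP[/eqP <-|/IH ->].
  by rewrite (negbTE qi).
by rewrite andbF.
Qed.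

End Sabotage.

(** * Cost and error of the combined algorithm *)

Section Cost.
Local Open Scope classical_set_scope.
Local Open Scope ring_scope.
Local Open Scope ereal_scope.
Variables (R : realType) (n : nat).

Lemma expected_queriesE (A : finType) (P : randomized_algorithm R n A) x :
  'E_P[fun t => (queries t x)%:R] = \int[P]_t (queries t x)%:R%:E.
Proof. by rewrite unlock. Qed.

Lemma worst_expected_queries_ge0 (A : finType) (P : randomized_algorithm R n A)
  (h : partial_fun n A) : 0 <= worst_expected_queries P h.
Proof. exact: bigmax_ge_id. Qed.

Lemma le_worst_expected_queries (A : finType) (P : randomized_algorithm R n A)
  (h : partial_fun n A) x : h x ->
  'E_P[fun t => (queries t x)%:R] <= worst_expected_queries P h.
Proof. by move=> hx; rewrite /worst_expected_queries; exact: le_bigmax_cond. Qed.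

Lemma Rbar_ge0 (A : finType) (eps : R) (h : partial_fun n A) : 0 <= Rbar eps h.
Proof.
by apply: le_ereal_inf_tmp => _ [P _ <-]; exact: worst_expected_queries_ge0.
Qed.

Lemma Rbar_le (A : finType) (eps eps' : R) (h : partial_fun n A) :
  (eps <= eps')%R -> Rbar eps' h <= Rbar eps h.
Proof.
move=> le_eps; apply: le_ereal_inf => _ [P Perr <-]; exists P => // x hx.
by apply: le_trans (Perr x hx); rewrite lee_fin lerB.
Qed.

Variables P Q : randomized_algorithm R n symbol.

Definition resume_pair (z : dtree n symbol * dtree n symbol) : dtree n symbol :=
  resume z.1 z.2.

HB.instance Definition _ := isMeasurableFun.Build _ _ _ _ resume_pair
  (@measurable_fun_dtree2 _ _ _ _ _ _).

Definition resume_algorithm : randomized_algorithm R n symbol :=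
  distribution (P \x Q) resume_pair.

(** By independence, the expectation of the extra cost factors into the probability that [t] reads
    no mark and the expected cost of [s]. *)
Lemma expected_queries_resume q :
  'E_resume_algorithm[fun t => (queries t q)%:R] <=
  'E_P[fun t => (queries t q)%:R] +
  P [set t | reads_no_mark t q] * 'E_Q[fun t => (queries t q)%:R].
Proof.
rewrite !expected_queriesE; set EQ := \int[Q]_t _; set N := [set t | _].
have queries_ge0 t : 0 <= (queries t q)%:R%:E :> \bar R by rewrite lee_fin.
have EQ_ge0 : 0 <= EQ by exact: integral_ge0.
rewrite ge0_integral_distribution//.
(* Integrate over [s] first, with [t] fixed. *)
rewrite fubini_tonelli1; [|exact: measurable_fun_dtree2|by move=> z /=].
have inner t : \int[Q]_s (queries (resume t s) q)%:R%:E <=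
    (queries t q)%:R%:E + (\1_N t)%:E * EQ.
  rewrite -ge0_integralZl//.
  have -> : (queries t q)%:R%:E = \int[Q]_s (queries t q)%:R%:E :> \bar R.
    rewrite integral_cst// -[LHS]mule1; congr (_ * _).
    by apply/esym; exact: probability_setT.
  rewrite -ge0_integralD//.
  apply: ge0_le_integral => //.
  move=> s _; rewrite -EFinM -EFinD lee_fin indicE mem_setE.
  by rewrite -natrM -natrD ler_nat queries_resume.
have outer : \int[P]_t ((queries t q)%:R%:E + (\1_N t)%:E * EQ) =
    \int[P]_t (queries t q)%:R%:E + P N * EQ.
  rewrite ge0_integralD//; last by move=> t _; rewrite mule_ge0// lee_fin.
  by rewrite ge0_integralZr// integral_indic// setIT.
rewrite -outer; apply: ge0_le_integral => //.
by move=> t _; apply: integral_ge0 => s _; exact: queries_ge0.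
by move=> t _; exact: inner.
Qed.

(** Whenever [s] is right on [q], so is [resume t s], whatever [t] is. *)
Lemma has_error_resume (f : partial_fun n bool) :
  has_error 0 Q (fsab f) -> has_error 0 resume_algorithm (fsab f).
Proof.
move=> Qerr q fq; apply: (le_trans (Qerr q fq)).
rewrite -[leLHS]mul1e -(probability_setT P) -product_measure1E//.
apply: le_measure; rewrite ?inE; try exact: measurable_dtree2.
move=> [t s] [_ /= fqs]; apply: output_resume => //.
by apply/implyP => _; apply/eqP.
Qed.

Lemma has_errorC (A : finType) (M : randomized_algorithm R n A) (eps : R)
  (h : partial_fun n A) x : has_error eps M h -> h x ->
  M [set t | h x <> Some (output t x)] <= eps%:E.
Proof.
move=> Merr hx; have := Merr x hx.
rewrite (_ : [set t | _ <> _] = ~` [set t | h x = Some (output t x)])//.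
rewrite probability_setC//.
rewrite -[M _]fineK ?fin_num_measure// -EFinB !lee_fin; lra.
Qed.

Lemma reads_no_mark_prob (f : partial_fun n bool) (eps : R) q :
  has_error eps P (fsab f) -> fsab f q ->
  P [set t | reads_no_mark t q] <= (2 * eps)%:E.
Proof.
move=> Perr fq; case fqE: (fsab f q) (fq) => [b|] // _.
have fq'E := fsab_swap_marks fqE.
have fq' : fsab f (swap_marks q) by rewrite fq'E.
have -> : (2 * eps)%:E = eps%:E + eps%:E by rewrite -EFinD; congr EFin; ring.
apply: (le_trans _ (leeD (has_errorC Perr fq) (has_errorC Perr fq'))).
(* Union bound: the event lies in the union of the error events at [q] and at [swap_marks q]. *)
apply: (le_trans _ (measureU2 _ _ _)) => //.
apply: le_measure; rewrite ?inE//.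
move=> t /= /output_swap_marks tq; rewrite fqE fq'E tq.
by case: b {fqE fq'E} (output t q) => -[]; by [left|right].
Qed.

Lemma worst_expected_queries_resume (f : partial_fun n bool) (eps : R) :
  has_error eps P (fsab f) ->
  worst_expected_queries resume_algorithm (fsab f) <=
  worst_expected_queries P (fsab f)
  + (2 * eps)%:E * worst_expected_queries Q (fsab f).
Proof.
move=> Perr.
(* Over an empty domain all costs are 0; otherwise [2 * eps] bounds a probability, hence is
   nonnegative. *)
have [[q fq]|nofq] := pselect (exists q, fsab f q); last first.
  rewrite /worst_expected_queries !big_pred0 ?mule0 ?adde0// => q;
  by apply/negP => fq; apply: nofq; exists q.
have eps2_ge0 : 0 <= (2 * eps)%:E.
  exact: le_trans (measure_ge0 _ _) (reads_no_mark_prob Perr fq).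
apply: bigmax_le.
  by rewrite adde_ge0 ?mule_ge0 ?worst_expected_queries_ge0.
move=> {fq}q fq; apply: (le_trans (expected_queries_resume q)).
have E_ge0 (M : randomized_algorithm R n symbol) :
    0 <= 'E_M[fun t => (queries t q)%:R].
  exact: expectation_ge0.
apply: leeD; first exact: le_worst_expected_queries.
apply: lee_pmul => //; first exact: reads_no_mark_prob Perr fq.
exact: le_worst_expected_queries.
Qed.

End Cost.

(** * Finiteness of [R0] and passage to the infimum *)

Section MainBound.
Local Open Scope classical_set_scope.
Local Open Scope ring_scope.
Local Open Scope ereal_scope.
Variables (R : realType) (n : nat) (f : partial_fun n bool).

(** The point mass at a tree that scans for a mark has zero error and finite cost. *)
Lemma R0_fsab_fin_num : R0 R (fsab f) \is a fin_num.
Proof.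
rewrite ge0_fin_numE ?Rbar_ge0//.
pose t := resume (scan n) (Leaf n symbol false).
pose D : randomized_algorithm R n symbol := \d_t.
apply: (@le_lt_trans _ _ (worst_expected_queries D (fsab f))).
  apply: ereal_inf_lbound; exists D => // q fq.
  rewrite subr0 /D /= diracE mem_set//=.
  by apply: output_resume => //; rewrite (scan_reads_mark fq).
apply: bigmax_lt => // q _; rewrite expected_queriesE.
by rewrite integral_dirac// ?diracT ?mul1e ?ltry.
Qed.

Lemma R0_fsab_le (eps : R) (P : randomized_algorithm R n symbol) :
  (0 <= eps)%R -> has_error eps P (fsab f) ->
  R0 R (fsab f) <=
  worst_expected_queries P (fsab f) + (2 * eps)%:E * R0 R (fsab f).
Proof.
move=> eps_ge0 Perr; have R0fin := R0_fsab_fin_num.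
apply/lee_addgt0Pr => e e_gt0.
(* Slack allowed to [Q]: multiplied by [2 * eps] it stays at most [e], and the [+ 1] covers
   [eps = 0]. *)
have d_gt0 : (0 < e / (2 * eps + 1))%R by rewrite divr_gt0//; lra.
have [_ [Q Qerr <-] Qlt] := lb_ereal_inf_adherent d_gt0 R0fin.
apply: (@le_trans _ _ (worst_expected_queries (resume_algorithm P Q) (fsab f))).
  apply: ereal_inf_lbound; exists (resume_algorithm P Q) => //.
  exact: has_error_resume.
apply: (le_trans (worst_expected_queries_resume Q Perr)).
rewrite -addeA leeD2l//.
apply: (@le_trans _ _
  ((2 * eps)%:E * (R0 R (fsab f) + (e / (2 * eps + 1))%:E))).
  by apply: lee_wpmul2l; [rewrite lee_fin; lra|exact: ltW].
rewrite -(fineK R0fin) -EFinD -!EFinM -EFinD lee_fin mulrDr lerD2l.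
rewrite mulrCA; apply: ler_piMr; first exact: ltW.
by rewrite ler_pdivrMr; lra.
Qed.

End MainBound.

Theorem theorem11 (R : realType) (n : nat) (f : partial_fun n bool) (eps : R)
    (eps_ge0 : (0 <= eps)%R) :
  (Rbar eps (fsab f) <= R0 R (fsab f))%E /\
  ((1 - 2 * eps)%R%:E * R0 R (fsab f) <= Rbar eps (fsab f))%E.
Proof.
split; first exact: Rbar_le.
apply: le_ereal_inf_tmp => _ [P Perr <-].
have := R0_fsab_le eps_ge0 Perr.
(* Finiteness allows the term [2 * eps * R0] to be moved across the inequality. *)
have := R0_fsab_fin_num R f.
case: (R0 R (fsab f)) => [r| |] // _.
case: (worst_expected_queries P (fsab f)) => [w| |] //=; last first.
  by move=> _; rewrite leey.
rewrite -!EFinM -EFinD !lee_fin; lra.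
Qed.
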